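(* Let $(X,d)$ and $(Y,\rho)$ be two metric spaces. Then the following statements are equivalent. (1) Every locally Lipschitz function $f:(X,d)\to(Y,\rho)$ is quasi-Cauchy Lipschitz. (2) Every real valued locally Lipschitz function defined on $X$ is quasi-Cauchy Lipschitz. (3) $X$ is Bourbaki quasi-complete.
   Context: A sequence $(x_n)$ in a metric space $(X,d)$ is quasi-Cauchy if for every $\varepsilon>0$ there is $n_0$ such that $d(x_{n+1},x_n)<\varepsilon$ for all $n\ge n_0$. A function $f:(X,d)\to(Y,\rho)$ is quasi-Cauchy Lipschitz if for any quasi-Cauchy sequence $(x_n)$ in $X$ there exists $\lambda>0$ such that $\rho(f(x_k),f(x_{k+1}))\le\lambda d(x_k,x_{k+1})$ for all $k\in\mathbb{N}$. It is locally Lipschitz if for each $x\in X$ there exists $\delta_x>0$ such that $f$ restricted to the open ball $B_{\delta_x}(x)$ is Lipschitz. For $\varepsilon>0$ and $p\in X$, $B^\infty_\varepsilon(p)$ is the set of points $q\in X$ for which there are finitely many points $p=p_0,p_1,\dots,p_n=q$ in $X$ with $d(p_{i-1},p_i)<\varepsilon$ for $i=1,\dots,n$. A sequence $(x_n)$ is Bourbaki quasi-Cauchy in $X$ if for every $\varepsilon>0$ there exist $n_0\in\mathbb{N}$ and $p\in X$ such that $x_n\in B^\infty_\varepsilon(p)$ for every $n\ge n_0$. $X$ is Bourbaki quasi-complete if every Bourbaki quasi-Cauchy sequence in $X$ has a cluster point in $X$ (i.e. a convergent subsequence).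
   Formalization: In (1) the space Y ranges over all metric spaces instead of being fixed in advance; for a fixed Y the equivalence fails, e.g. Y a single point and X = (0,1), where (1) holds but (2) and (3) fail. *)

(* Defs.v *)
From HB Require Import structures.
From mathcomp Require Import all_boot all_order all_algebra.
From mathcomp Require Import all_classical all_reals all_analysis.

Set Implicit Arguments.
Unset Strict Implicit.
Unset Printing Implicit Defensive.

Import Order.TTheory GRing.Theory Num.Theory.
Import numFieldNormedType.Exports.

Local Open Scope classical_set_scope.
Local Open Scope ring_scope.

Section Sequences.
Context {R : realType} {X : metricType R}.

Definition quasi_cauchy (x : nat -> X) : Prop :=
  forall e : R, 0 < e ->
    exists n0 : nat, forall n : nat, (n0 <= n)%N -> mdist (x n.+1) (x n) < e.

(* Only the values [c 0], ..., [c n] of the chain [c] matter. *)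
Definition chain_ball (p : X) (e : R) : set X :=
  [set q | exists (n : nat) (c : nat -> X),
    [/\ c 0%N = p, c n = q &
        forall i : nat, (i < n)%N -> mdist (c i) (c i.+1) < e]].

Definition bourbaki_quasi_cauchy (x : nat -> X) : Prop :=
  forall e : R, 0 < e ->
    exists (n0 : nat) (p : X), forall n : nat, (n0 <= n)%N -> chain_ball p e (x n).

End Sequences.

Definition bourbaki_quasi_complete {R : realType} (X : metricType R) : Prop :=
  forall x : nat -> X, bourbaki_quasi_cauchy x ->
    exists p : X, cluster (x @ \oo) p.

(* The library's [lipschitz] notions are restricted to normed modules. *)
Section Lipschitz.
Context {R : realType} {X Y : metricType R}.

Definition metric_lipschitz_on (A : set X) (f : X -> Y) : Prop :=
  exists2 k : R, 0 < k &
    forall x y : X, A x -> A y -> mdist (f x) (f y) <= k * mdist x y.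

Definition locally_lipschitz (f : X -> Y) : Prop :=
  forall x : X, exists2 delta : R, 0 < delta & metric_lipschitz_on (ball x delta) f.

Definition quasi_cauchy_lipschitz (f : X -> Y) : Prop :=
  forall x : nat -> X, quasi_cauchy x ->
    exists2 lambda : R, 0 < lambda &
      forall k : nat, mdist (f (x k)) (f (x k.+1)) <= lambda * mdist (x k) (x k.+1).

End Lipschitz.

(* Main.v *)
Require Import Defs.
From HB Require Import structures.
From mathcomp Require Import all_boot all_order all_algebra.
From mathcomp Require Import all_classical all_reals all_analysis.
From mathcomp Require Import lra.

Set Implicit Arguments.
Unset Strict Implicit.
Unset Printing Implicit Defensive.

Import Order.TTheory GRing.Theory Num.Theory.
Import numFieldNormedType.Exports.

Local Open Scope classical_set_scope.
Local Open Scope ring_scope.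

(* If the ratio of increments of f is unbounded along a quasi-Cauchy sequence x,
   then it exceeds n at some index k_n >= n; the sequence x (k_n) is Bourbaki
   quasi-Cauchy, and f is not Lipschitz near a cluster point of it.  Conversely,
   a Bourbaki quasi-Cauchy sequence without cluster point has a subsequence z
   whose terms can be linked by ever finer chains into a quasi-Cauchy sequence y.
   Since z has no cluster point, a locally finite sum of bumps gives a locally
   Lipschitz f whose value at z k exceeds k times the length of y up to z k, so
   that f is not quasi-Cauchy Lipschitz along y. *)

(** * Cluster points and chains *)

Lemma cluster_seqP (R : realType) (X : metricType R) (x : nat -> X) (p : X) :
  cluster (x @ \oo) p <->
  forall d : R, 0 < d ->
    forall N : nat, exists2 n : nat, (N <= n)%N & mdist p (x n) < d.
Proof.
split=> [xp d d0 N | xp A B [N _ xA] /nbhs_ballP[d d0 dB]].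
  have [||q [[n Nn <-]]] := xp [set x n | n in [set n | (N <= n)%N]] (ball p d).
  - by exists N => // n Nn; exists n.
  - exact: nbhsx_ballx.
  - by rewrite ballEmdist => pn; exists n.
have [n Nn pn] := xp d d0 N.
by exists (x n); split; [exact: xA | apply: dB; rewrite ballEmdist].
Qed.

Lemma chain_ball_sym (R : realType) (X : metricType R) (p q : X) (e : R) :
  chain_ball p e q -> chain_ball q e p.
Proof.
move=> [n [c [c0 cn ce]]]; exists n, (fun i => c (n - i)%N).
split; rewrite ?subn0 ?subnn // => i ilt.
by rewrite metric_sym -[in X in mdist _ X](subnSK ilt) ce // subnSK // leq_subr.
Qed.

Lemma chain_ball_trans (R : realType) (X : metricType R) (p q r : X) (e : R) :
  chain_ball p e q -> chain_ball q e r -> chain_ball p e r.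
Proof.
move=> [n [c [c0 cn ce]]] [m [b [b0 bm be]]].
exists (n + m)%N, (fun i => if (i <= n)%N then c i else b (i - n)%N).
split=> //.
  case: ifP => [|_]; last by rewrite addKn.
  rewrite -[X in (_ <= X)%N]addn0 leq_add2l leqn0 => /eqP m0.
  by rewrite m0 addn0 cn -b0 -bm m0.
move=> i inm; case: (ltngtP i n) => [ilt | nlt | ein].
- exact: ce.
- by rewrite subSn ?(ltnW nlt) // be // ltn_subLR // ltnW.
- rewrite ein in inm *.
  by rewrite cn -b0 subSnn be // -(ltn_add2l n) addn0.
Qed.

(** The terms of [x] between the indices [n0] and [k n] are themselves the required chain, so [k]
    may be any map with [n <= k n]. *)
Lemma quasi_cauchy_subseq (R : realType) (X : metricType R) (x : nat -> X)
    (k : nat -> nat) :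
  quasi_cauchy x -> (forall n, (n <= k n)%N) ->
  bourbaki_quasi_cauchy (fun n => x (k n)).
Proof.
move=> xqc kn e /xqc[n0 xe]; exists n0, (x n0) => n n0n.
have le_n0 : (n0 <= k n)%N by exact: leq_trans n0n (kn n).
exists (k n - n0)%N, (fun i => x (n0 + i)%N); split; rewrite ?addn0 ?subnKC //.
by move=> i _; rewrite addnS metric_sym xe // leq_addr.
Qed.

(** * Quasi-completeness bounds the ratios of increments *)

Lemma quasi_complete_locally_lipschitz (R : realType) (X Y : metricType R)
    (f : X -> Y) :
  bourbaki_quasi_complete X -> locally_lipschitz f -> quasi_cauchy_lipschitz f.
Proof.
move=> Xqc fll x xqc; apply: contrapT => nlip.
have bad (N : nat) : exists k : nat, (N <= k)%N /\
    N%:R * mdist (x k) (x k.+1) < mdist (f (x k)) (f (x k.+1)).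
  apply: contrapT => nbad; apply: nlip.
  (* If no index from [N] on is bad, [N] bounds the later ratios and [S] the first [N] ones; the
     extra 1 makes the constant positive. *)
  pose q k := mdist (f (x k)) (f (x k.+1)) / mdist (x k) (x k.+1).
  have q0 k : 0 <= q k by rewrite divr_ge0 ?mdist_ge0.
  pose S := \sum_(0 <= k < N) q k.
  have S0 : 0 <= S by rewrite sumr_ge0.
  exists (N%:R + S + 1) => [|k].
    by rewrite ltr_wpDl // addr_ge0.
  have d0 := mdist_ge0 (x k) (x k.+1).
  have [kN | Nk] := ltnP k N.
    have [->|xk] := eqVneq (x k) (x k.+1); first by rewrite !mdistxx mulr0.
    rewrite -ler_pdivrMr ?mdist_gt0 // (@le_trans _ _ S) //.
      rewrite /S big_mkord (bigD1 (Ordinal kN)) //= lerDl sumr_ge0 //.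
    by rewrite -addrA addrCA lerDl addr_ge0.
  rewrite (@le_trans _ _ (N%:R * mdist (x k) (x k.+1))) //.
    by rewrite leNgt; apply/negP => lt; apply: nbad; exists k.
  by rewrite ler_wpM2r // -addrA lerDl addr_ge0.
have [k kP] := choice bad.
have kge n : (n <= k n)%N by have [] := kP n.
have [p /cluster_seqP xp] := Xqc _ (quasi_cauchy_subseq xqc kge).
have [d d0 [C C0 fC]] := fll p.
(* With [x (k n)] within [d / 2] of [p] and its next step below [d / 2], both endpoints lie in the
   ball where [C] is a Lipschitz constant, while [n] exceeds [C]. *)
have d20 : 0 < d / 2 by rewrite divr_gt0.
have [n0 xd] := xqc _ d20.
have [n] := xp _ d20 (maxn n0 (Num.bound C)); rewrite geq_max => /andP[n0n Cn] pn.
have [_] := kP n; apply/negP; rewrite -leNgt.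
have xkd := xd _ (leq_trans n0n (kge n)).
rewrite metric_sym in xkd.
apply: le_trans (fC _ _ _ _) _; rewrite ?ballEmdist /=.
- by rewrite (lt_trans pn) // gtr_pMr // invf_lt1 // ltr1n.
- by rewrite (le_lt_trans (metric_triangle _ (x (k n)) _)) // (splitr d) ltrD.
rewrite ler_wpM2r ?mdist_ge0 // ltW // (lt_le_trans (archi_boundP (ltW C0))) //.
by rewrite ler_nat.
Qed.

(** * Locally finite sums of bumps *)

Section Bumps.
Context {R : realType} {X : metricType R}.
Implicit Types (z : nat -> X) (h : nat -> R).

(** A tent centred at [z k]; the radius 1/(k+1) of its support tends to 0, whatever its height. *)
Definition bump z h k (x : X) : R :=
  `|h k| * Num.max 0 (1 - k.+1%:R * mdist (z k) x).

Lemma bump_ge0 z h k x : 0 <= bump z h k x.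
Proof. by rewrite mulr_ge0 // le_max lexx. Qed.

Lemma bump_lipschitz z h k x y :
  `|bump z h k y - bump z h k x| <= `|h k| * k.+1%:R * mdist x y.
Proof.
rewrite /bump -mulrBr normrM normr_id -mulrA ler_wpM2l //.
have maxE (a b : R) : `|Num.max 0 b - Num.max 0 a| <= `|b - a|.
  case: (lerP 0 b) => ?; case: (lerP 0 a) => ?;
    case: (ler0P (b - a)) => ?; rewrite ?ler_norml; lra.
apply: le_trans (maxE _ _) _; rewrite opprB addrC addrA subrK -mulrBr normrM.
rewrite ger0_norm // ler_wpM2l // ler_norml.
have := metric_triangle (z k) x y; have := metric_triangle (z k) y x.
by rewrite (metric_sym y x); lra.
Qed.

Lemma bump_eq0 z h k x : k.+1%:R^-1 <= mdist (z k) x -> bump z h k x = 0.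
Proof.
move=> kx; rewrite /bump max_l ?mulr0 // subr_le0.
by rewrite -ler_pdivrMl // mulr1.
Qed.

(** Eventually [z k] stays at distance at least [d] from [p] and the support radius falls below
    [d / 2], so the support misses the ball of radius [d / 2] about [p]. *)
Lemma bump_locally_finite z h (p : X) :
  ~ cluster (z @ \oo) p ->
  exists2 d : R, 0 < d & exists N : nat, forall k x,
    (N <= k)%N -> ball p d x -> bump z h k x = 0.
Proof.
move=> /cluster_seqP/existsNP[d /not_implyP[d0 /existsNP[N zN]]].
have d20 : 0 < d / 2 by rewrite divr_gt0.
have [M _ Md] := near_infty_natSinv_lt (PosNum d20).
exists (d / 2) => //; exists (maxn N M) => k x.
rewrite geq_max ballEmdist => /andP[Nk /Md/= kd] /= px.
apply/bump_eq0/ltW/(lt_trans kd).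
have dk : d <= mdist p (z k).
  by rewrite leNgt; apply/negP => pk; apply: zN; exists k.
have := metric_triangle p x (z k); rewrite (metric_sym x) => tri.
by move: px tri dk; rewrite [in X in _ -> _ -> X -> _](splitr d); lra.
Qed.

Lemma locally_lipschitz_above z h : (forall p, ~ cluster (z @ \oo) p) ->
  exists2 f : X -> R^o, locally_lipschitz f & forall k, h k <= f (z k).
Proof.
move=> zcl; pose F n x : R := \sum_(0 <= k < n) bump z h k x.
have stable x M n : (forall k, (M <= k)%N -> bump z h k x = 0) ->
    (M <= n)%N -> F n x = F M x.
  move=> Mx Mn; rewrite /F (big_cat_nat (leq0n M) Mn) /=.
  by rewrite [X in _ + X]big_nat_cond [X in _ + X]big1 ?addr0 // => k /andP[/andP[/Mx]].
have fin x : exists N, forall k, (N <= k)%N -> bump z h k x = 0.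
  have [d d0 [N dN]] := bump_locally_finite h (zcl x).
  by exists N => k Nk; apply: dN => //; exact: ballxx.
have [N NP] := choice fin.
(* The infinite sum is cut at an index depending on the point; by [stable] any later cut gives the
   same value, so near [p] the function is one fixed finite sum [F M]. *)
exists (fun x => F (N x) x : R^o) => [p|k].
  have [d d0 [M dM]] := bump_locally_finite h (zcl p).
  exists d => //.
  have C0 : 0 <= \sum_(0 <= k < M) `|h k| * k.+1%:R :> R.
    by rewrite sumr_ge0 // => k _; rewrite mulr_ge0.
  have FM x : ball p d x -> F (N x) x = F M x.
    move=> px; rewrite -(stable x _ (maxn M (N x)) (NP x) (leq_maxr _ _)).
    by rewrite (stable x M) ?leq_maxl // => k Mk; exact: dM.
  exists (\sum_(0 <= k < M) `|h k| * k.+1%:R + 1) => [|x y px py].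
    by rewrite ltr_wpDl.
  rewrite (FM x px) (FM y py).
  have -> : mdist (F M x : R^o) (F M y) = `|F M y - F M x| by [].
  rewrite (@le_trans _ _ ((\sum_(0 <= k < M) `|h k| * k.+1%:R) * mdist x y)) //.
    rewrite /F -sumrB mulr_suml (le_trans (ler_norm_sum _ _ _)) // ler_sum //.
    by move=> k _; exact: bump_lipschitz.
  by rewrite ler_wpM2r ?mdist_ge0 // lerDl.
rewrite -(stable _ _ (maxn (N (z k)) k.+1) (NP _) (leq_maxl _ _)).
rewrite (@le_trans _ _ (bump z h k (z k))) //.
  by rewrite /bump mdistxx mulr0 subr0 max_r // mulr1 ler_norm.
rewrite /F big_mkord (bigD1 (Ordinal (leq_maxr (N (z k)) k.+1))) //=.
by rewrite lerDl sumr_ge0 // => i _; exact: bump_ge0.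
Qed.

End Bumps.

(** * Concatenation of infinitely many chains *)

Section Interpolation.
Context (n : nat -> nat).

(* Chains of n 0, n 1, ... steps are run through one after the other; the pair
   (k, i) is the i-th point of the k-th chain. *)
Definition chain_next (s : nat * nat) : nat * nat :=
  if (s.2 < n s.1)%N then (s.1, s.2.+1) else (s.1.+1, 0%N).

Definition chain_pos (t : nat) : nat * nat := iter t chain_next (0%N, 0%N).

(** A chain of [n j] steps has [(n j).+1] points; the point where two chains meet is visited twice,
    as the end of one and the start of the next. *)
Definition chain_start (k : nat) : nat := (\sum_(0 <= j < k) (n j).+1)%N.

Lemma chain_pos_le t : ((chain_pos t).2 <= n (chain_pos t).1)%N.
Proof. by case: t => //= t; rewrite /chain_next; case: ifP. Qed.

Lemma chain_pos_start k : chain_pos (chain_start k) = (k, 0%N).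
Proof.
elim: k => [|k IH]; first by rewrite /chain_start big_nil.
have run i : (i <= n k)%N -> chain_pos (i + chain_start k)%N = (k, i).
  elim: i => [|i IHi] ik //.
  by rewrite addSn /chain_pos iterS -/(chain_pos _) IHi 1?ltnW // /chain_next /= ik.
rewrite /chain_start big_nat_recr //= addnC addSn -/(chain_start k).
by rewrite /chain_pos iterS -/(chain_pos _) run // /chain_next /= ltnn.
Qed.

Lemma chain_pos_mono t u : (t <= u)%N -> ((chain_pos t).1 <= (chain_pos u).1)%N.
Proof.
apply: (homo_leq (f := fun t => (chain_pos t).1) (r := leq)) => //.
  exact: leq_trans.
by move=> s; rewrite /= /chain_next; case: ifP => _ /=.
Qed.

End Interpolation.

Lemma quasi_cauchy_through (R : realType) (X : metricType R) (z : nat -> X) :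
  (forall k, chain_ball (z k) k.+1%:R^-1 (z k.+1)) ->
  exists (y : nat -> X) (t : nat -> nat),
    quasi_cauchy y /\ forall k, y (t k) = z k.
Proof.
move=> /choice[n /choice[c cP]].
pose y t := c (chain_pos n t).1 (chain_pos n t).2.
have ystep t : mdist (y t) (y t.+1) < (chain_pos n t).1.+1%:R^-1.
  have := chain_pos_le n t; rewrite /y /= /chain_next.
  case: (chain_pos n t) => k i /= ik; have [_ cn ce] := cP k.
  case: ifPn => [/ce//|]; rewrite -leqNgt => ni.
  (* At a junction both points are [z k.+1], so this step has length 0. *)
  have -> : i = n k by apply/eqP; rewrite eqn_leq ik.
  by have [c0 _ _] := cP k.+1; rewrite cn /= c0 mdistxx invr_gt0.
exists y, (chain_start n); split => [e e0|k]; last first.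
  by rewrite /y chain_pos_start; have [] := cP k.
have [M _ Me] := near_infty_natSinv_lt (PosNum e0).
exists (chain_start n M) => t Mt; rewrite metric_sym (lt_trans (ystep t)) //.
by apply: Me; have := chain_pos_mono n Mt; rewrite chain_pos_start.
Qed.

Lemma bourbaki_quasi_cauchy_linked (R : realType) (X : metricType R)
    (x : nat -> X) : bourbaki_quasi_cauchy x ->
  exists2 phi : nat -> nat, (forall k, (k <= phi k)%N) &
    forall k, chain_ball (x (phi k)) k.+1%:R^-1 (x (phi k.+1)).
Proof.
move=> xb; have /choice[n nP] (k : nat) : exists n : nat, exists p : X,
    forall m, (n <= m)%N -> chain_ball p k.+1%:R^-1 (x m).
  by apply: xb; rewrite invr_gt0.
(* The sum puts both [phi k] and [phi k.+1] past [n k], so the two terms are chained through the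
   same [p]. *)
exists (fun k => k + \sum_(0 <= j < k.+1) n j)%N => [k|k].
  exact: leq_addr.
have [p xp] := nP k.
have nk : (n k <= \sum_(0 <= j < k.+1) n j)%N by rewrite big_nat_recr ?leq_addl.
apply: (chain_ball_trans (q := p)).
  by apply/chain_ball_sym/xp; rewrite (leq_trans nk) ?leq_addl.
apply/xp/(leq_trans nk)/(leq_trans _ (leq_addl _ _)).
by rewrite [leqRHS]big_nat_recr //= leq_addr.
Qed.

Lemma locally_lipschitz_quasi_complete (R : realType) (X : metricType R) :
  (forall f : X -> R^o, locally_lipschitz f -> quasi_cauchy_lipschitz f) ->
  bourbaki_quasi_complete X.
Proof.
move=> XR x xb; apply: contrapT => /forallNP xcl.
have [phi phi_ge xphi] := bourbaki_quasi_cauchy_linked xb.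
have [y [t [yqc yt]]] := quasi_cauchy_through xphi.
have zcl p : ~ cluster ((fun k => x (phi k)) @ \oo) p.
  move=> /cluster_seqP zp; apply: (xcl p); apply/cluster_seqP => d d0 N.
  have [k Nk pk] := zp d d0 N.
  by exists (phi k) => //; exact: leq_trans (phi_ge k).
pose L m : R := \sum_(0 <= i < m) mdist (y i) (y i.+1).
have L0 m : 0 <= L m by rewrite sumr_ge0 // => i _; exact: mdist_ge0.
(* A Lipschitz bound [l] along [y] would give [k * (1 + L (t k)) <= f (y 0) + l * L (t k)]. For
   large [k], the summand 1 beats [f (y 0)] and the summand [L (t k)] beats the term in [l]. *)
have [f fll fz] := locally_lipschitz_above (fun k => k%:R * (1 + L (t k))) zcl.
have [l l0 fl] := XR f fll y yqc.
have fL m : f (y m) <= f (y 0%N) + l * L m.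
  elim: m => [|m IH]; first by rewrite /L big_nil mulr0 addr0.
  rewrite /L big_nat_recr //= -/(L m) mulrDr addrA.
  have := le_trans (ler_norm _) (fl m).
  by rewrite lerBlDl => /le_trans; apply; rewrite lerD2r.
set k := Num.bound (l + `|f (y 0%N)|).
have kP : l + `|f (y 0%N)| < k%:R by apply: archi_boundP; rewrite addr_ge0 // ltW.
have := le_trans (fz k) _; rewrite -yt => /(_ _ (fL _)); apply/negP; rewrite -ltNge.
have := L0 (t k); have := ler_norm (f (y 0%N)); have := normr_ge0 (f (y 0%N)).
move: kP; set a := `|f _|; set b := f _; set K := k%:R; set M := L _ => *.
have : l * M <= K * M by rewrite ler_wpM2r //; lra.
by rewrite mulrDr mulr1; lra.
Qed.

(* The target space of the first item ranges over all metric spaces: for a fixed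
   one, such as a singleton, the equivalence fails.  The real line, with the
   distance |y - x|, is the metric space R^o. *)
Theorem theorem4p2 (R : realType) (X : metricType R) :
  [<-> forall (Y : metricType R) (f : X -> Y),
         locally_lipschitz f -> quasi_cauchy_lipschitz f;
       forall f : X -> R^o,
         locally_lipschitz f -> quasi_cauchy_lipschitz f;
       bourbaki_quasi_complete X].
Proof.
tfae.
- by move=> H f; exact: H.
- exact: locally_lipschitz_quasi_complete.
- by move=> Xqc Y f; exact: quasi_complete_locally_lipschitz.
Qed.
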